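(* Let $m\geq2$, and let $1<p_1,\ldots,p_m<\infty$ satisfy $$\sum_{i=1}^m\frac1{p_i}=1.$$ There is no constant $C>0$ such that $$\big\|T^K(f_1,\ldots,f_m)\big\|_{1,\infty}\leq C\Big(\prod_{i=1}^m\|f_i\|_{p_i}\Big)\|K\|_{1,\infty}$$ for all $f_i\in L^{p_i}(\mathbb{R}^n)$, $i=1,\ldots,m$, and all $K\in L^{1,\infty}((\mathbb{R}^n)^m)$.
   Context: Here $n\ge1$ is an integer and $m$ is an integer. $\|f\|_p$ is the $L^p$ norm. $\|f\|_{1,\infty}=\sup_{\lambda>0}\lambda\,|\{|f|>\lambda\}|$ is the weak $L^1$ quasi-norm, and $L^{1,\infty}$ is the space of measurable functions for which it is finite. For a measurable function $K$ on $(\mathbb{R}^n)^m$ and measurable functions $f_1,\ldots,f_m$ on $\mathbb{R}^n$, $$T^K(f_1,\ldots,f_m)(x)=\int_{(\mathbb{R}^n)^m}\Big(\prod_{i=1}^m f_i(x-y_i)\Big)K(y_1,\ldots,y_m)\,dy_1\cdots dy_m,$$ defined at those $x$ where the integral converges absolutely. For nonnegative functions it is well defined with values in $[0,\infty]$. Since $|T^K(f_1,\ldots,f_m)|\le T^{|K|}(|f_1|,\ldots,|f_m|)$, one uses the standard reduction to nonnegative functions and kernels. *)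

(* Defs.v *)
From HB Require Import structures.
From mathcomp Require Import all_boot all_order all_algebra.
From mathcomp Require Import all_classical all_reals all_analysis.
Set Implicit Arguments.
Unset Strict Implicit.
Unset Printing Implicit Defensive.
Import Order.TTheory GRing.Theory Num.Theory.
Import numFieldNormedType.Exports.
Local Open Scope classical_set_scope.
Local Open Scope ring_scope.
Local Open Scope ereal_scope.

Definition cons_pair (T : Type) n (z : T * n.-tuple T) : n.+1.-tuple T :=
  [the n.+1.-tuple T of z.1 :: z.2].

Lemma measurable_cons_pair d (T : measurableType d) n :
  measurable_fun [set: T * n.-tuple T] (@cons_pair T n).
Proof. exact: measurable_cons. Qed.

(* The n-fold product of mu, with T ^ n.+1 identified with T * T ^ n. *)
Fixpoint power_measure d (T : measurableType d) (R : realType)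
    (mu : set T -> \bar R) n : set (n.-tuple T) -> \bar R :=
  match n with
  | 0 => \d_([tuple] : 0.-tuple T)
  | k.+1 => pushforward (mu \x power_measure mu (n := k)) (@cons_pair T k)
  end.
Arguments power_measure {d T R} mu n.

(* The library declares no canonical sigma-finite structure on mu \x nu. *)
Lemma product_sigma_finite d1 d2 (T1 : measurableType d1)
    (T2 : measurableType d2) (R : realType)
    (m1 : {sigma_finite_measure set T1 -> \bar R})
    (m2 : {sigma_finite_measure set T2 -> \bar R}) :
  sigma_finite setT (m1 \x m2).
Proof.
have /sigma_finiteP[F [TF ndF Foo]] := sigma_finiteT m1.
have /sigma_finiteP[G [TG ndG Goo]] := sigma_finiteT m2.
exists (fun n => F n `*` G n).
  rewrite -setXTT TF TG predeqE => -[x y]; split.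
    move=> [/= [n _ Fnx] [k _ Gky]]; exists (maxn n k) => //; split.
    - by move: x Fnx; exact/subsetPset/ndF/leq_maxl.
    - by move: y Gky; exact/subsetPset/ndG/leq_maxr.
  by move=> [n _ []/= ? ?]; split; exists n.
move=> k; have [? ?] := Foo k; have [? ?] := Goo k.
split; first exact: measurableX.
by rewrite product_measure1E// lte_mul_pinfty// ge0_fin_numE.
Qed.

Section power_measure_step.
Context d (T : measurableType d) (R : realType) (n : nat).
Variable mu : {sigma_finite_measure set T -> \bar R}.
Variable M : {sigma_finite_measure set (n.-tuple T) -> \bar R}.

Let step := pushforward (mu \x M) (@cons_pair T n).

Let uncons (x : n.+1.-tuple T) : T * n.-tuple T :=
  (tnth x ord0, [tuple of behead x]).

Let cons_pairK : cancel (@cons_pair T n) uncons.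
Proof. by case=> a t; congr pair; apply/val_inj. Qed.

Let measurable_uncons : measurable_fun [set: n.+1.-tuple T] uncons.
Proof.
apply/measurable_fun_pairP; split; first exact: measurable_tnth.
exact: measurable_behead.
Qed.

Let step0 : step set0 = 0.
Proof. by rewrite /step /pushforward preimage_set0 measure0. Qed.

Let step_ge0 A : 0 <= step A.
Proof. exact: (measure_ge0 (mu \x M)). Qed.

Let step_sigma_additive : semi_sigma_additive step.
Proof.
move=> F mF tF mUF; rewrite /step /pushforward preimage_bigcup.
have mc := @measurable_cons_pair _ T n.
apply: measure_semi_sigma_additive.
- by move=> k; rewrite -[X in measurable X]setTI; exact: mc.
- apply/trivIsetP => /= i j _ _ ij; rewrite -preimage_setI.
  by move/trivIsetP : tF => /(_ _ _ _ _ ij) ->//; rewrite preimage_set0.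
- by rewrite -preimage_bigcup -[X in measurable X]setTI; exact: mc.
Qed.

HB.instance Definition _ := isMeasure.Build _ _ _
  step step0 step_ge0 step_sigma_additive.

Let step_sigma_finite : sigma_finite setT step.
Proof.
have [F FT F_fin] := product_sigma_finite mu M.
exists (fun k => uncons @^-1` F k).
  by rewrite -preimage_bigcup -FT preimage_setT.
move=> k; have [mF Foo] := F_fin k; split.
  by rewrite -[X in measurable X]setTI; exact: measurable_uncons.
rewrite /step /pushforward -comp_preimage.
by rewrite (_ : uncons \o _ = id)//; apply/funext => z; exact: cons_pairK.
Qed.

HB.instance Definition _ := Measure_isSigmaFinite.Build _ _ _
  step step_sigma_finite.

Lemma power_measure_step : exists
  M' : {sigma_finite_measure set (n.+1.-tuple T) -> \bar R},
  M' = pushforward (mu \x M) (@cons_pair T n) :> (set _ -> \bar R).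
Proof. by exists step. Qed.

End power_measure_step.

Section power_measure_sigma_finite.
Context d (T : measurableType d) (R : realType).
Variables (mu : {sigma_finite_measure set T -> \bar R}) (n : nat).

Let power_measure_ex : exists
  M : {sigma_finite_measure set (n.-tuple T) -> \bar R},
  M = power_measure mu n :> (set _ -> \bar R).
Proof.
elim: n => [|k [M ME]].
  by exists \d_([tuple] : 0.-tuple T).
by have [M' M'E] := power_measure_step mu M; exists M'; rewrite M'E ME.
Qed.

Let power_measure0 : power_measure mu n set0 = 0.
Proof. by have [M <-] := power_measure_ex; exact: measure0. Qed.

Let power_measure_ge0 A : 0 <= power_measure mu n A.
Proof. by have [M <-] := power_measure_ex; exact: measure_ge0. Qed.

Let power_measure_sigma_additive : semi_sigma_additive (power_measure mu n).
Proof.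
by have [M <-] := power_measure_ex; exact: measure_semi_sigma_additive.
Qed.

HB.instance Definition _ := isMeasure.Build _ _ _ (power_measure mu n)
  power_measure0 power_measure_ge0 power_measure_sigma_additive.

Let power_measure_sigma_finite : sigma_finite setT (power_measure mu n).
Proof. by have [M <-] := power_measure_ex; exact: sigma_finiteT. Qed.

HB.instance Definition _ := Measure_isSigmaFinite.Build _ _ _
  (power_measure mu n) power_measure_sigma_finite.

End power_measure_sigma_finite.

Lemma power_measure_box d (T : measurableType d) (R : realType)
    (mu : {sigma_finite_measure set T -> \bar R}) n (A : 'I_n -> set T) :
  (forall i, measurable (A i)) ->
  power_measure mu n [set x | forall i, A i (tnth x i)] = \prod_(i < n) mu (A i).
Proof.
elim: n A => [|n IHn] A mA.
  by rewrite big_ord0 /= diracE mem_set//= => -[].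
rewrite big_ord_recl -IHn; last by move=> i; exact: mA.
rewrite /= /pushforward.
set B := [set x : n.-tuple T | _].
have mB : measurable B.
  rewrite (_ : B = \bigcap_(i in [set: 'I_n])
      ((@tnth n T ^~ i) @^-1` A (lift ord0 i))).
    apply: fin_bigcap_measurable => // i _.
    by rewrite -[X in measurable X]setTI; exact: measurable_tnth.
  by apply/seteqP; split => [x Bx i _|x Bx i]; [exact: Bx|exact: (Bx i I)].
rewrite -product_measure1E//; congr product_measure1.
apply/seteqP; split => -[a t] /=.
  move=> H; split; first exact: (H ord0).
  by move=> i; have := H (lift ord0 i); rewrite tnthS.
move=> [Aa Bt] i; case: (unliftP ord0 i) => [j ->|->//].
by rewrite tnthS; exact: Bt.
Qed.

(* R^n, with the product Borel sigma-algebra. *)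
Notation vec R n := (n.-tuple (measurableTypeR R)).

Definition vec_sub (R : realType) n (x y : vec R n) : vec R n :=
  [tuple (tnth x i - tnth y i)%R | i < n].

Definition lebesgue_vec (R : realType) n : set (vec R n) -> \bar R :=
  power_measure (@lebesgue_measure R) n.
Arguments lebesgue_vec : clear implicits.

HB.instance Definition _ (R : realType) n :=
  SigmaFiniteMeasure.on (lebesgue_vec R n).

(* Lebesgue measure on (R^n)^m *)
Definition lebesgue_vecs (R : realType) n m : set (m.-tuple (vec R n)) -> \bar R :=
  power_measure (lebesgue_vec R n) m.
Arguments lebesgue_vecs : clear implicits.

HB.instance Definition _ (R : realType) n m :=
  SigmaFiniteMeasure.on (lebesgue_vecs R n m).

Definition weakL1_norm d (T : measurableType d) (R : realType)
    (mu : set T -> \bar R) (g : T -> \bar R) : \bar R :=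
  ereal_sup [set l%:E * mu [set x | l%:E < `|g x|] | l in [set l | (0 < l)%R]].

Definition in_weakL1 d (T : measurableType d) (R : realType)
    (mu : set T -> \bar R) (g : T -> R) : Prop :=
  measurable_fun setT g /\ weakL1_norm mu (EFin \o g) < +oo.

Section multilinear_convolution.
Context (R : realType) (n m : nat).
Variables (K : m.-tuple (vec R n) -> R) (f : 'I_m -> vec R n -> R).

Definition convT_integrand (x : vec R n) (y : m.-tuple (vec R n)) : R :=
  (\prod_(i < m) f i (vec_sub x (tnth y i)) * K y)%R.

(* The points where T^K(f_1,...,f_m) is defined: those where the integral
   converges absolutely, and all points, with values in [0, +oo], when the f_i
   and K are nonnegative. *)
Definition convT_dom : set (vec R n) :=
  [set x | (lebesgue_vecs R n m).-integrable setT (EFin \o convT_integrand x) \/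
           (forall i z, 0 <= f i z)%R /\ (forall y, 0 <= K y)%R].

(* The value 0 outside of convT_dom does not affect the sets {|T^K| > l},
   l > 0. *)
Definition convT : vec R n -> \bar R :=
  (fun x => \int[lebesgue_vecs R n m]_y (convT_integrand x y)%:E) \_ convT_dom.

End multilinear_convolution.

(* Main.v *)
Require Import Defs.
From mathcomp Require Import all_boot all_order all_algebra.
From mathcomp Require Import all_classical all_reals all_analysis measurable_realfun.
From mathcomp Require Import lra.
Set Implicit Arguments.
Unset Strict Implicit.
Unset Printing Implicit Defensive.
Import Order.TTheory GRing.Theory Num.Theory.
Local Open Scope classical_set_scope.
Local Open Scope ring_scope.
Local Open Scope ereal_scope.

(** The obstruction is the logarithmic divergence of |y|^(-nm) at infinity:
    this kernel is in weak L^1 but not in L^1.  Nonnegative data leave no room for cancellation,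
    so it suffices to choose the f_i constant on a region large enough for
    T^K(f_1,...,f_m) to see the whole integral of a truncation of that kernel.

    The kernel is replaced by a dyadic model of it.  Let Q_k be the cube of
    half-side 2^k in (R^n)^m; it has volume a * a^k with a = 2^(nm).  Put
    K = sum over k < N of a^(-k) 1_(Q_k).  Every term has the same integral a, so
    K has integral N a (integral_geometric_stack); but outside Q_(j-1) only the
    terms k >= j survive, and they form a geometric series bounded by 2 a^(-j),
    so the weak L^1 quasi-norm of K is at most 2 a, whatever N is
    (weakL1_norm_geometric_stack).

    Let f_i be the indicator of the cube of half-side 2^(N+1) in R^n, for every i.
    If x is in the cube of half-side 2^N and y is in the support of K, then all
    x - y_i are in the larger cube, whence T^K(f_1,...,f_m)(x) = N a
    (convT_indic_cube).  The weak norm of T^K(f_1,...,f_m) is therefore at least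
    (N a / 2) v, where v is the volume of the smaller cube, while the product of
    the norms of the f_i is the volume 2^n v of the larger cube, because the
    exponents 1/p_i sum to 1 (Lnorm_prod_indic).  A constant C would then satisfy
    N <= 4 C 2^n for all N. *)

(** * A kernel of bounded weak norm and large integral *)

Section geometric_stack.
Context d (T : measurableType d) (R : realType).
Variables (mu : {measure set T -> \bar R}) (A : nat -> set T) (a q : R).
Hypotheses (mA : forall k, measurable (A k)) (q_ge2 : (2 <= q)%R).
Hypotheses (muA : forall k, mu (A k) = (a * q ^+ k)%:E).

Definition geometric_stack N (x : T) : R :=
  (\sum_(k < N) q ^- k * \1_(A k) x)%R.

Let q_gt0 : (0 < q)%R. Proof. by move: q_ge2; lra. Qed.

Lemma geometric_stack_ge0 N x : (0 <= geometric_stack N x)%R.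
Proof.
apply: sumr_ge0 => k _; rewrite mulr_ge0// invr_ge0 exprn_ge0//.
exact: ltW.
Qed.

Lemma geometric_stack_eq0 N x :
  (forall k, (k < N)%N -> ~ A k x) -> geometric_stack N x = 0%R.
Proof.
move=> nA; rewrite /geometric_stack big1// => k _.
by rewrite indicE memNset ?mulr0//; exact: nA.
Qed.

Lemma measurable_geometric_stack N : measurable_fun setT (geometric_stack N).
Proof.
by apply: measurable_sum => k; exact: measurable_funM.
Qed.

(** The measure of A k grows at exactly the rate at which its weight decays. *)
Lemma integral_geometric_stack N :
  \int[mu]_x (geometric_stack N x)%:E = (N%:R * a)%:E.
Proof.
under eq_integral do rewrite /geometric_stack -sumEFin.
rewrite ge0_integral_sum//=; last 2 first.
- by move=> k; apply/measurable_EFinP; exact: measurable_funM.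
- by move=> k x _; rewrite lee_fin mulr_ge0// invr_ge0 exprn_ge0// ltW.
transitivity (\sum_(k < N) a%:E); last first.
  by rewrite sumEFin big_const_ord iter_addr_0 mulr_natl.
apply: eq_bigr => k _; under eq_integral do rewrite EFinM.
rewrite ge0_integralZl_EFin//; last 2 first.
- by apply/measurable_EFinP; exact: measurable_indic.
- by rewrite invr_ge0 exprn_ge0// ltW.
rewrite integral_indic// setIT muA -EFinM mulrCA mulVf ?mulr1//.
by rewrite expf_neq0// gt_eqF.
Qed.

(** A point outside A 0, ..., A (j - 1) only sees the terms from j on, a
    geometric series of ratio at most 1/2. *)
Lemma geometric_stack_le N j x :
  (forall k, (k < j)%N -> ~ A k x) -> (geometric_stack N x <= 2 * q ^- j)%R.
Proof.
move=> nA.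
(* As q >= 2, q^-k <= 2 q^-k - 2 q^-(k+1), so that the sum telescopes; the
   subtracted term makes the induction on N go through. *)
suff : (geometric_stack N x <= 2 * q ^- j - 2 * q ^- maxn j N)%R.
  have : (0 <= q ^- maxn j N)%R by rewrite invr_ge0 exprn_ge0// ltW.
  by lra.
elim: N => [|N IHN].
  by rewrite maxn0 subrr geometric_stack_eq0.
have [Nj|jN] := ltnP N j.
  rewrite (maxn_idPl Nj) subrr geometric_stack_eq0// => k kN; apply: nA.
  exact: leq_trans kN _.
rewrite /geometric_stack big_ord_recr/= -/(geometric_stack N x).
rewrite (maxn_idPr jN) in IHN; rewrite (maxn_idPr (leqW jN)).
have le1 : (\1_(A N) x <= 1 :> R)%R by rewrite indicE; case: (_ \in _).
have qN0 : (0 < q ^- N)%R by rewrite invr_gt0 exprn_gt0.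
have step : (2 * q ^- N.+1 <= q ^- N)%R.
  rewrite exprS invfM mulrA ler_piMl ?(ltW qN0)//.
  by rewrite ler_pdivrMr// mul1r.
have : (q ^- N * \1_(A N) x <= q ^- N)%R by rewrite ler_piMr// ltW.
by move: step IHN; lra.
Qed.

(** The superlevel set {stack > l}, unless empty, is contained in some A J with
    l < 2 q^-J, by geometric_stack_le, and then l * mu (A J) < 2 q^-J * a q^J = 2 a. *)
Lemma weakL1_norm_geometric_stack N : (0 <= a)%R ->
  {homo A : i j / (i <= j)%N >-> i `<=` j} ->
  weakL1_norm mu (EFin \o geometric_stack N) <= (2 * a)%:E.
Proof.
move=> a_ge0 ndA; apply: ub_ereal_sup => _ [l /= l_gt0 <-].
set S := [set x | _].
have mS : measurable S.
  rewrite /S -[X in measurable X]setTI; apply: emeasurable_fun_o_infty => //.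
  do 2 apply: measurableT_comp => //; exact: measurable_geometric_stack.
have SP x : S x -> (l < geometric_stack N x)%R.
  by rewrite /S /= ger0_norm ?geometric_stack_ge0// lte_fin.
have mu_le J : S `<=` A J -> (l < 2 * q ^- J)%R -> l%:E * mu S <= (2 * a)%:E.
  move=> SAJ l_lt; apply: (@le_trans _ _ (l%:E * mu (A J))).
    by rewrite lee_pmul2l// le_measure// inE.
  rewrite muA -EFinM lee_fin mulrCA [leRHS]mulrC ler_wpM2l//.
  by rewrite -ler_pdivlMr ?exprn_gt0// ltW.
(* Descent on J: if the level l is too high for A J.+1, the superlevel set is
   already contained in A J; below A 0 it is empty. *)
suff SA J : S `<=` A J -> l%:E * mu S <= (2 * a)%:E.
  apply: (SA N) => x /SP/(lt_trans l_gt0) Kx; apply: contrapT => nAx.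
  move: Kx; rewrite geometric_stack_eq0 ?ltxx// => k kN Akx.
  by apply: nAx; exact: (ndA k N (ltnW kN) x Akx).
elim: J => [|J IHJ] SAJ.
  have [l_lt|l_ge] := ltP l (2 * q ^- 0)%R; first exact: (mu_le 0%N SAJ l_lt).
  rewrite (_ : S = set0) ?measure0 ?mule0 ?lee_fin ?mulr_ge0//.
  rewrite -subset0 => x /SP; rewrite ltNge => /negP; apply.
  by apply: le_trans l_ge; exact: geometric_stack_le.
have [l_lt|l_ge] := ltP l (2 * q ^- J.+1)%R; first exact: (mu_le J.+1 SAJ l_lt).
apply: IHJ => x /SP; rewrite ltNge => /negP Kx; apply: contrapT => nAx.
apply: Kx; apply: le_trans l_ge; apply: geometric_stack_le => k kJ Akx.
by apply: nAx; exact: (ndA k J kJ x Akx).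
Qed.

End geometric_stack.

(** * Cubes in R^n and in (R^n)^m *)

Lemma measurable_forall_tnth d (T : measurableType d) k (A : set T) :
  measurable A -> measurable [set x : k.-tuple T | forall i, A (tnth x i)].
Proof.
move=> mA.
rewrite (_ : [set x | _] = \bigcap_(i in [set: 'I_k]) (@tnth k T ^~ i @^-1` A)).
  apply: fin_bigcap_measurable => // i _.
  by rewrite -[X in measurable X]setTI; exact: measurable_tnth.
by apply/seteqP; split => [x Ax i _|x Ax i]; [exact: Ax|exact: (Ax i I)].
Qed.

Section cubes.
Context (R : realType) (n : nat).

Definition cube (r : R) : set (vec R n) :=
  [set x | forall i, `](- r)%R, r[%classic (tnth x i)].

Definition cubes m (r : R) : set (m.-tuple (vec R n)) :=
  [set y | forall i, cube r (tnth y i)].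

Lemma measurable_cube r : measurable (cube r).
Proof. by apply: measurable_forall_tnth; exact: measurable_itv. Qed.

Lemma measurable_cubes m r : measurable (@cubes m r).
Proof. by apply: measurable_forall_tnth; exact: measurable_cube. Qed.

Lemma lebesgue_cube (r : R) : (0 < r)%R ->
  lebesgue_vec R n (cube r) = ((2 * r) ^+ n)%:E.
Proof.
move=> r_gt0; pose I : set (measurableTypeR R) := `](- r)%R, r[%classic.
transitivity (\prod_(i < n) lebesgue_measure I).
  apply: (@power_measure_box _ _ _ lebesgue_measure n (fun=> I)) => _.
  exact: measurable_itv.
have -> : lebesgue_measure I = (2 * r)%:E.
  rewrite /I lebesgue_measure_itv/= lte_fin ifT; last by lra.
  by rewrite -EFinB; congr EFin; lra.
by rewrite prodEFin prodr_const card_ord.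
Qed.

Lemma lebesgue_cubes m (r : R) : (0 < r)%R ->
  lebesgue_vecs R n m (@cubes m r) = ((2 * r) ^+ (n * m))%:E.
Proof.
move=> r_gt0; transitivity (\prod_(i < m) lebesgue_vec R n (cube r)).
  apply: (@power_measure_box _ _ _ (lebesgue_vec R n) m (fun=> cube r)) => _.
  exact: measurable_cube.
rewrite lebesgue_cube//.
by rewrite prodEFin prodr_const card_ord exprM.
Qed.

Lemma le_cube (r s : R) : (r <= s)%R -> cube r `<=` cube s.
Proof.
move=> rs x xr i; have /= := xr i; rewrite !in_itv/=; lra.
Qed.

Lemma le_cubes m (r s : R) : (r <= s)%R -> @cubes m r `<=` @cubes m s.
Proof. by move=> rs x xr i; exact: le_cube rs _ (xr i). Qed.

Lemma cube_sub (r s : R) x y : cube r x -> cube s y ->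
  cube (r + s) (vec_sub x y).
Proof.
move=> xr ys i; have /= := ys i; have /= := xr i.
by rewrite tnth_mktuple !in_itv/=; lra.
Qed.

End cubes.

(** * Norms of indicators *)

Section indicator_Lp.
Context d (T : measurableType d) (R : realType).
Variables (mu : {measure set T -> \bar R}) (A : set T).
Hypothesis mA : measurable A.

Lemma Lnorm_indic (r : R) : r != 0%R ->
  'N[mu]_(r%:E)[EFin \o \1_A] = mu A `^ r^-1.
Proof.
move=> r0; rewrite unlock; congr (_ `^ _).
rewrite -[in RHS](setIT A) -integral_indic//; apply: eq_integral => x _ /=.
rewrite indicE; case: (_ \in _) => /=.
  by rewrite normr1 powR1.
by rewrite normr0 powR0.
Qed.

Lemma indic_in_Lfun (r : R) : r != 0%R -> mu A < +oo ->
  (\1_A : T -> R) \in Lfun mu r%:E.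
Proof.
move=> r0 Aoo; rewrite inE; apply/andP; split; rewrite inE/=.
  exact: measurable_indic.
by rewrite /finite_norm Lnorm_indic// poweR_lty.
Qed.

End indicator_Lp.

(** Comparing A with the superlevel set needs the latter to be measurable, hence
    the measurability of g. *)
Lemma ge_weakL1_norm d (T : measurableType d) (R : realType)
    (mu : {measure set T -> \bar R}) (g : T -> \bar R) (A : set T) (l : R) :
  measurable A -> measurable_fun setT g -> (0 < l)%R ->
  (forall x, A x -> l%:E < g x) -> l%:E * mu A <= weakL1_norm mu g.
Proof.
move=> mA mg l_gt0 Ag.
apply: (@le_trans _ _ (l%:E * mu [set x | l%:E < `|g x|])); last first.
  by apply: ereal_sup_ubound; exists l.
rewrite lee_pmul2l// le_measure ?inE//.
  rewrite -[X in measurable X]setTI; apply: emeasurable_fun_o_infty => //.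
  exact: measurableT_comp.
move=> x /Ag l_lt /=; apply: lt_le_trans l_lt _; exact: lee_abs.
Qed.

Lemma powR_sum (R : realType) (I : Type) (s : seq I) (e : I -> R) (v : R) :
  (0 < v)%R -> (\prod_(i <- s) v `^ e i = v `^ (\sum_(i <- s) e i))%R.
Proof.
move=> v_gt0; rewrite (big_morph (powR v) (id1 := 1%R) (op1 := *%R))//.
- by move=> x y; rewrite powRD//; apply/implyP => _; rewrite gt_eqF.
- by rewrite powRr0.
Qed.

(** With reciprocal exponents summing to 1, the powers of the measure of A
    recombine into the measure itself. *)
Lemma Lnorm_prod_indic d (T : measurableType d) (R : realType)
    (mu : {measure set T -> \bar R}) m (p : 'I_m -> R) (A : set T) (v : R) :
  (forall i, p i != 0)%R -> (\sum_(i < m) (p i)^-1 = 1)%R ->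
  measurable A -> mu A = v%:E -> (0 < v)%R ->
  \prod_(i < m) 'N[mu]_((p i)%:E)[EFin \o \1_A] = v%:E.
Proof.
move=> p_neq0 sum_inv_p mA muA v_gt0.
transitivity (\prod_(i < m) (v `^ (p i)^-1)%:E).
  by apply: eq_bigr => i _; rewrite Lnorm_indic ?muA.
by rewrite prodEFin powR_sum// sum_inv_p powRr1// ltW.
Qed.

(** * The operator on nonnegative data *)

Section nonnegative_convolution.
Context (R : realType) (n m : nat).
Variables (K : m.-tuple (vec R n) -> R) (f : 'I_m -> vec R n -> R).
Hypotheses (K_ge0 : forall y, (0 <= K y)%R) (f_ge0 : forall i x, (0 <= f i x)%R).

Lemma ge0_convTE x :
  convT K f x = \int[lebesgue_vecs R n m]_y (convT_integrand K f x y)%:E.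
Proof. by rewrite /convT patchE ifT// inE; right. Qed.

Lemma measurable_vec_sub_tnth i :
  measurable_fun [set: vec R n * m.-tuple (vec R n)]
    (fun z => vec_sub z.1 (tnth z.2 i)).
Proof.
apply/measurable_fun_tnthP => j.
rewrite (_ : _ \o _ =
    (fun z : vec R n * m.-tuple (vec R n) =>
       tnth z.1 j - tnth (tnth z.2 i) j)%R); last first.
  by apply/funext => z /=; rewrite tnth_mktuple.
apply: measurable_funB.
  by apply: (measurableT_comp (measurable_tnth j)); exact: measurable_fst.
apply: (measurableT_comp (measurable_tnth j)).
by apply: (measurableT_comp (measurable_tnth i)); exact: measurable_snd.
Qed.

(** Tonelli's theorem, applied to the jointly measurable integrand. *)
Lemma measurable_ge0_convT :
  measurable_fun setT K -> (forall i, measurable_fun setT (f i)) ->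
  measurable_fun setT (convT K f).
Proof.
move=> mK mf; rewrite (_ : convT K f =
    fubini_F (lebesgue_vecs R n m)
      (fun z => (convT_integrand K f z.1 z.2)%:E)); last first.
  by apply/funext => x; rewrite ge0_convTE.
apply: measurable_fun_fubini_tonelli_F => /=; last first.
  by move=> z; rewrite lee_fin mulr_ge0// prodr_ge0.
apply/measurable_EFinP; apply: measurable_funM.
  apply: measurable_prod => i _.
  by apply: (measurableT_comp (mf i)); exact: measurable_vec_sub_tnth.
by apply: (measurableT_comp mK); exact: measurable_snd.
Qed.

End nonnegative_convolution.

(** The sum of two cubes of half-side r is contained in the cube of half-side
    r + r, so that the factors f_i equal 1 on the whole support of K. *)
Lemma convT_indic_cube (R : realType) n m (K : m.-tuple (vec R n) -> R) r x :
  (forall y, (0 <= K y)%R) -> (forall y, ~ cubes r y -> K y = 0%R) ->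
  cube r x ->
  convT K (fun=> \1_(cube (r + r))) x = \int[lebesgue_vecs R n m]_y (K y)%:E.
Proof.
move=> K_ge0 K0 xr; rewrite ge0_convTE//.
apply: eq_integral => y _; rewrite /convT_integrand; congr EFin.
have [yr|/K0 ->] := pselect (cubes r y); last by rewrite mulr0.
rewrite big1 ?mul1r// => i _; rewrite indicE mem_set//.
by apply: cube_sub => //; exact: yr.
Qed.

(** * Unboundedness *)

Theorem proposition6p1 (R : realType) (n m : nat) (p : 'I_m -> R)
    (n_ge1 : (1 <= n)%N) (m_ge2 : (2 <= m)%N)
    (p_gt1 : forall i, (1 < p i)%R)
    (sum_inv_p : (\sum_(i < m) (p i)^-1 = 1)%R) :
  ~ exists C : R, (0 < C)%R /\
      forall (f : 'I_m -> vec R n -> R) (K : m.-tuple (vec R n) -> R),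
        (forall i, f i \in Lfun (lebesgue_vec R n) (p i)%:E) ->
        in_weakL1 (lebesgue_vecs R n m) K ->
        weakL1_norm (lebesgue_vec R n) (convT K f) <=
          C%:E *
          (\prod_(i < m) 'N[lebesgue_vec R n]_((p i)%:E)[EFin \o f i]) *
          weakL1_norm (lebesgue_vecs R n m) (EFin \o K).
Proof.
move=> [C [C_gt0 bound]].
have p_neq0 i : p i != 0%R by have := p_gt1 i; lra.
pose D := (n * m)%N.
have D_gt0 : (0 < D)%N by rewrite muln_gt0 n_ge1 (ltnW m_ge2).
pose a : R := (2 ^+ D)%R.
have a_ge2 : (2 <= a)%R by rewrite /a -[leLHS]expr1 ler_weXn2l// ler1n.
pose Q k : set (m.-tuple (vec R n)) := cubes (2 ^+ k)%R.
have pow2_gt0 k : (0 < 2 ^+ k :> R)%R by rewrite exprn_gt0.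
have mQ k : measurable (Q k) by exact: measurable_cubes.
have muQ k : lebesgue_vecs R n m (Q k) = (a * a ^+ k)%:E.
  by rewrite lebesgue_cubes// -/D exprMn /a -!exprM (mulnC k).
have ndQ : {homo Q : i j / (i <= j)%N >-> i `<=` j}.
  by move=> i j ij; apply: le_cubes; rewrite ler_weXn2l// ler1n.
have [N CN] : exists N, (4 * C * 2 ^+ n < N%:R)%R.
  exists (Num.bound (4 * C * 2 ^+ n)%R); apply: archi_boundP.
  by rewrite !mulr_ge0 ?ltW.
have N_gt0 : (0 < N%:R :> R)%R.
  by apply: lt_trans CN; rewrite !mulr_gt0.
pose K := geometric_stack Q a N.
pose f (_ : 'I_m) : vec R n -> R := \1_(cube (2 ^+ N + 2 ^+ N)).
have K_ge0 y : (0 <= K y)%R by exact: geometric_stack_ge0.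
have mK : measurable_fun setT K by exact: measurable_geometric_stack.
have K_weak : weakL1_norm (lebesgue_vecs R n m) (EFin \o K) <= (2 * a)%:E.
  by apply: weakL1_norm_geometric_stack => //; lra.
have mcube (r : R) : measurable (cube r : set (vec R n)).
  exact: measurable_cube.
pose v : R := ((2 * 2 ^+ N) ^+ n)%R.
have v_gt0 : (0 < v)%R by rewrite exprn_gt0// mulr_gt0.
have cubeE : lebesgue_vec R n (cube (2 ^+ N + 2 ^+ N)) = (2 ^+ n * v)%:E.
  by rewrite lebesgue_cube ?addr_gt0// /v -exprMn; congr ((_ ^+ _)%:E); lra.
have f_Lp i : f i \in Lfun (lebesgue_vec R n) (p i)%:E.
  apply: indic_in_Lfun => //.
  by move: (ltry (2 ^+ n * v)); rewrite -cubeE.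
have K_weakL1 : in_weakL1 (lebesgue_vecs R n m) K.
  by split => //; apply: le_lt_trans K_weak (ltry _).
have := bound f K f_Lp K_weakL1.
rewrite (Lnorm_prod_indic p_neq0 sum_inv_p _ cubeE) ?mulr_gt0//.
(* Superlevel sets are defined by a strict inequality, so the level has to lie
   below the value N a that the operator takes on the small cube: half of it. *)
have lower : (N%:R * a / 2)%:E * (v%:E) <=
    weakL1_norm (lebesgue_vec R n) (convT K f).
  rewrite -(lebesgue_cube n (pow2_gt0 N)).
  apply: ge_weakL1_norm => //.
  - apply: measurable_ge0_convT => // i.
    exact: measurable_indic.
  - by rewrite divr_gt0// mulr_gt0//; lra.
  move=> x xN; rewrite convT_indic_cube//; last first.
    move=> y yN; apply: geometric_stack_eq0 => k kN Qky; apply: yN.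
    exact: (ndQ k N (ltnW kN) y Qky).
  rewrite (integral_geometric_stack mQ a_ge2 muQ) lte_fin.
  have : (0 < N%:R * a)%R by rewrite mulr_gt0//; lra.
  by lra.
move=> /(le_trans lower); apply/negP; rewrite -ltNge.
apply: (@le_lt_trans _ _ ((C * (2 ^+ n * v)) * (2 * a))%:E).
  by rewrite -EFinM [leRHS]EFinM lee_pmul2l// lte_fin !mulr_gt0.
rewrite -EFinM lte_fin.
have av : (0 < a * v)%R by rewrite mulr_gt0//; lra.
have : (4 * C * 2 ^+ n * (a * v) < N%:R * (a * v))%R by rewrite ltr_pM2r.
by move: (2 ^+ n)%R => e; lra.
Qed.
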